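(* Let $\mathcal{O}_{ad}$ be an admissible family of open subsets of $\mathbb{R}^d$, let $\mathcal{J}\colon \mathcal{O}_{ad}\to\mathbb{R}$ be a functional, and let $\mu\in\mathcal{P}_{ad}(\mathbb{R}^d)$. Assume that $\mathcal{J}$ is shape-differentiable at $\Omega_\mu$, with shape derivative $d_S\mathcal{J}(\Omega_\mu)$. Then for each $\theta\in W^{1,\infty}(\mathbb{R}^d;\mathbb{R}^d)$, the measure $(\mathrm{Id}+t\theta)_\sharp\mu$ belongs to $\mathcal{P}_{ad}(\mathbb{R}^d)$ for all small $t>0$, the map $$t\mapsto \widetilde{\mathcal{J}}\big((\mathrm{Id}+t\theta)_\sharp\mu\big)$$ is differentiable at $t=0$, and its derivative at $t=0$ equals $\langle d_S\mathcal{J}(\Omega_\mu),\theta\rangle$.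
   Context: $\mathcal{P}_2(\mathbb{R}^d)$ is the set of Borel probability measures on $\mathbb{R}^d$ with finite second moment. $\Phi_\sharp\mu$ denotes the push-forward of $\mu$ under $\Phi$, and $\mathrm{Id}$ is the identity map of $\mathbb{R}^d$. Elements of $W^{1,\infty}(\mathbb{R}^d;\mathbb{R}^d)$ are identified with their bounded Lipschitz representatives. Let $\mathcal{O}$ be the set of all open subsets of $\mathbb{R}^d$ and $\mathcal{O}_{ad}\subset\mathcal{O}$ a subfamily. $\mathcal{O}_{ad}$ is admissible if it is stable under small perturbations: for every $\Omega\in\mathcal{O}_{ad}$ there is $r>0$ such that $(\mathrm{Id}+\theta)(\Omega)\in\mathcal{O}_{ad}$ for all $\theta\in W^{1,\infty}(\mathbb{R}^d;\mathbb{R}^d)$ with $\|\theta\|_{W^{1,\infty}}<r$. $\mathcal{J}\colon\mathcal{O}_{ad}\to\mathbb{R}$ is shape-differentiable at $\Omega\in\mathcal{O}_{ad}$ if there is a bounded linear functional $d_S\mathcal{J}(\Omega)$ on $W^{1,\infty}(\mathbb{R}^d;\mathbb{R}^d)$ (the shape derivative) such that $$\mathcal{J}((\mathrm{Id}+\theta)(\Omega))=\mathcal{J}(\Omega)+\langle d_S\mathcal{J}(\Omega),\theta\rangle+o(\theta),\qquad \frac{o(\theta)}{\|\theta\|_{W^{1,\infty}}}\to 0\ \text{ as } \|\theta\|_{W^{1,\infty}}\to 0 .$$ For $\mu\in\mathcal{P}_2(\mathbb{R}^d)$ put $\Omega_\mu:=\mathrm{Int}(\mathrm{supp}[\mu])$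 (interior of the support) and $\pi(\mu):=\Omega_\mu$. Put $\mathcal{P}_{ad}(\mathbb{R}^d):=\{\mu\in\mathcal{P}_2(\mathbb{R}^d)\mid \Omega_\mu\in\mathcal{O}_{ad}\}$ and $\widetilde{\mathcal{J}}:=\mathcal{J}\circ\pi\colon\mathcal{P}_{ad}(\mathbb{R}^d)\to\mathbb{R}$, i.e. $\widetilde{\mathcal{J}}(\mu)=\mathcal{J}(\Omega_\mu)$. *)

(* Defs.v *)
From HB Require Import structures.
From mathcomp Require Import all_boot all_order all_algebra.
From mathcomp Require Import ring.
From mathcomp Require Import all_classical all_reals all_analysis.

Set Implicit Arguments.
Unset Strict Implicit.
Unset Printing Implicit Defensive.

Import Order.TTheory GRing.Theory Num.Theory.
Import numFieldNormedType.Exports.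

Local Open Scope classical_set_scope.
Local Open Scope ring_scope.

(* The library norm of 'rV[R]_d is the maximum norm: it is used here only for
   the topology, all metric quantities being Euclidean. *)
Definition enorm (R : realType) (d : nat) (x : 'rV[R]_d) : R :=
  Num.sqrt (\sum_(i < d) x ord0 i ^+ 2).

Section enorm_theory.
Context {R : realType} {d : nat}.
Implicit Types x y : 'rV[R]_d.

Let ssq_ge0 x : 0 <= \sum_(i < d) x ord0 i ^+ 2.
Proof. by apply: sumr_ge0 => i _; exact: sqr_ge0. Qed.

Lemma enorm_ge0 x : 0 <= enorm x.
Proof. exact: sqrtr_ge0. Qed.

Lemma sqr_enorm x : enorm x ^+ 2 = \sum_(i < d) x ord0 i ^+ 2.
Proof. by rewrite sqr_sqrtr. Qed.

Lemma enormZ (a : R) x : enorm (a *: x) = `|a| * enorm x.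
Proof.
rewrite /enorm -sqrtr_sqr -sqrtrM ?sqr_ge0// mulr_sumr; congr Num.sqrt.
by apply: eq_bigr => i _; rewrite mxE exprMn.
Qed.

Lemma ler_coord_enorm x i : `|x ord0 i| <= enorm x.
Proof.
rewrite -sqrtr_sqr ler_sqrt// (bigD1 i)//= lerDl.
by apply: sumr_ge0 => j _; exact: sqr_ge0.
Qed.

Lemma enorm0 : enorm (0 : 'rV[R]_d) = 0.
Proof. by rewrite -(scale0r 0) enormZ normr0 mul0r. Qed.

Lemma enorm_eq0 x : enorm x = 0 -> x = 0.
Proof.
move=> x0; apply/rowP => i; rewrite mxE; apply/eqP.
by rewrite -normr_le0 -x0 ler_coord_enorm.
Qed.

Lemma enormD x y : enorm (x + y) <= enorm x + enorm y.
Proof.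
suff CS : \sum_(i < d) x ord0 i * y ord0 i <= enorm x * enorm y.
  rewrite -ler_sqr ?nnegrE ?addr_ge0 ?enorm_ge0// sqrrD !sqr_enorm.
  under eq_bigr do rewrite mxE sqrrD.
  by rewrite !big_split/= lerD2r lerD2l mulr2n lerD.
have [y0|y0] := eqVneq (enorm y) 0.
  rewrite y0 mulr0 big1// => i _.
  by rewrite (enorm_eq0 y0) mxE mulr0.
have [x0|x0] := eqVneq (enorm x) 0.
  rewrite x0 mul0r big1// => i _.
  by rewrite (enorm_eq0 x0) mxE mul0r.
have A0 : 0 < enorm x by rewrite lt_neqAle eq_sym x0 enorm_ge0.
have B0 : 0 < enorm y by rewrite lt_neqAle eq_sym y0 enorm_ge0.
rewrite -(ler_pM2l (mulr_gt0 A0 B0)) -expr2 exprMn -subr_ge0.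
rewrite -(@pmulr_rge0 _ 2)//.
suff -> : 2 * (enorm x ^+ 2 * enorm y ^+ 2 -
    enorm x * enorm y * \sum_(i < d) x ord0 i * y ord0 i) =
    \sum_(i < d) (enorm y * x ord0 i - enorm x * y ord0 i) ^+ 2.
  by apply: sumr_ge0 => i _; exact: sqr_ge0.
rewrite mulrBr mulr_natl mulr2n.
rewrite {1}(sqr_enorm x) {2}(sqr_enorm y) mulr_suml !mulr_sumr.
rewrite -big_split -sumrB/=; apply: eq_bigr => i _.
by ring.
Qed.

Lemma enormN x : enorm (- x) = enorm x.
Proof. by rewrite -scaleN1r enormZ normrN1 mul1r. Qed.

Lemma ler_norm_enorm x : `|x| <= enorm x.
Proof.
rewrite [leLHS]/Num.norm/= mx_normrE; apply/bigmax_leP; split.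
  exact: enorm_ge0.
by move=> [i j] _ /=; rewrite ord1 ler_coord_enorm.
Qed.

Lemma ler_enorm_norm x : enorm x <= d%:R * `|x|.
Proof.
rewrite -ler_sqr ?nnegrE ?enorm_ge0 ?mulr_ge0// sqr_enorm.
have coord i : x ord0 i ^+ 2 <= `|x| ^+ 2.
  rewrite -real_normK ?num_real// ler_sqr ?nnegrE//.
  rewrite [leRHS]/Num.norm/= mx_normrE.
  by apply/bigmax_geP; right => /=; exists (ord0, i).
apply: le_trans (ler_sum _ (fun i _ => coord i)) _.
rewrite sumr_const card_ord -[leLHS]mulr_natl exprMn ler_wpM2r ?sqr_ge0//.
by rewrite -natrX ler_nat; case: (d) => // n; rewrite leq_pmulr.
Qed.

End enorm_theory.

(* W^{1,oo}(R^d; R^d), as the space of the bounded Lipschitz maps. *)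
Definition w1inf (R : realType) (d : nat) : {pred 'rV[R]_d -> 'rV[R]_d} :=
  mem [set f : 'rV[R]_d -> 'rV[R]_d |
    (exists M, forall x, enorm (f x) <= M) /\
    (exists k, forall x y, enorm (f x - f y) <= k * enorm (x - y))].

Section w1inf_submod.
Context {R : realType} {d : nat}.

Lemma w1inf_submod_closed : submod_closed (@w1inf R d).
Proof.
split.
  apply/mem_set; split; first by exists 0 => x; rewrite enorm0.
  by exists 0 => x y; rewrite subrr enorm0 mul0r.
move=> a f g /set_mem[[M fM] [k fk]] /set_mem[[N gN] [l gl]].
apply/mem_set; split.
  exists (`|a| * M + N) => x; apply: le_trans (enormD _ _) _.
  by rewrite lerD// enormZ ler_wpM2l.
exists (`|a| * k + l) => x y.
rewrite [X in enorm X](_ : _ = a *: (f x - f y) + (g x - g y)); last first.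
  by rewrite scalerBr addrACA -opprD.
apply: le_trans (enormD _ _) _.
by rewrite mulrDl lerD// enormZ -mulrA ler_wpM2l.
Qed.

HB.instance Definition _ :=
  GRing.isSubmodClosed.Build _ _ (@w1inf R d) w1inf_submod_closed.

End w1inf_submod.

Record W1inf (R : realType) (d : nat) := MkW1inf {
  W1inf_fun :> 'rV[R]_d -> 'rV[R]_d ;
  _ : W1inf_fun \in @w1inf R d }.

HB.instance Definition _ (R : realType) (d : nat) :=
  [isSub for @W1inf_fun R d].
HB.instance Definition _ (R : realType) (d : nat) :=
  [Choice of W1inf R d by <:].
HB.instance Definition _ (R : realType) (d : nat) :=
  [SubChoice_isSubLmodule of W1inf R d by <:].

(* The pairs p with p.1 = p.2 contribute 0 / 0 = 0, which does not change the
   supremum. *)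
Definition lipschitz_const (R : realType) (d : nat)
    (f : 'rV[R]_d -> 'rV[R]_d) : R :=
  sup (range (fun p : 'rV[R]_d * 'rV[R]_d =>
    enorm (f p.1 - f p.2) / enorm (p.1 - p.2))).

(* For a bounded Lipschitz map the (Euclidean) Lipschitz constant is the
   L^oo norm of the operator norm of the weak differential. *)
Definition W1inf_norm (R : realType) (d : nat) (f : W1inf R d) : R :=
  sup (range (fun x => enorm (f x))) + lipschitz_const f.

Section W1inf_theory.
Context {R : realType} {d : nat}.
Implicit Types f g : W1inf R d.

Let E := 'rV[R]_d.
Let qt f (p : E * E) := enorm (f p.1 - f p.2) / enorm (p.1 - p.2).

Let W1infDE f g : f + g = (fun x => f x + g x) :> (E -> E). Proof. by []. Qed.
Let W1infZE a f : a *: f = (fun x => a *: f x) :> (E -> E). Proof. by []. Qed.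

Let has_sup_enorm f : has_sup (range (fun x => enorm (f x))).
Proof.
split; first by exists (enorm (f 0)); exists 0.
have /set_mem[[M fM] _] := valP f.
by exists M => _ [x _ <-]; exact: fM.
Qed.

Let has_sup_quot f : has_sup (range (qt f)).
Proof.
split; first by exists (qt f (0, 0)); exists (0, 0).
have /set_mem[_ [k fk]] := valP f.
exists (Num.max k 0) => _ [[x y] _ <-].
rewrite /qt/=; have [xy|xy] := eqVneq (enorm (x - y)) 0.
  by rewrite xy invr0 mulr0 le_max lexx orbT.
rewrite ler_pdivrMr ?lt_neqAle 1?eq_sym ?xy ?enorm_ge0//.
by rewrite (le_trans (fk _ _))// ler_wpM2r ?enorm_ge0// le_max lexx.
Qed.

Lemma enorm_le_sup f x : enorm (f x) <= sup (range (fun x => enorm (f x))).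
Proof. by apply: ub_le_sup; [case: (has_sup_enorm f)|exists x]. Qed.

Let quot_le f p : qt f p <= lipschitz_const f.
Proof. by apply: ub_le_sup; [case: (has_sup_quot f)|exists p]. Qed.

Lemma lipschitz_constP f x y :
  enorm (f x - f y) <= lipschitz_const f * enorm (x - y).
Proof.
have [xy|xy] := eqVneq (enorm (x - y)) 0.
  rewrite xy mulr0; have /eqP := enorm_eq0 xy; rewrite subr_eq0 => /eqP ->.
  by rewrite subrr enorm0.
rewrite -ler_pdivrMr ?lt_neqAle 1?eq_sym ?xy ?enorm_ge0//.
exact: (quot_le f (x, y)).
Qed.

Lemma lipschitz_const_ge0 f : 0 <= lipschitz_const f.
Proof.
by apply: le_trans (quot_le f (0, 0)); rewrite divr_ge0// enorm_ge0.
Qed.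

Let W1inf_norm_le f (M k : R) : (forall x, enorm (f x) <= M) ->
  (forall x y, enorm (f x - f y) <= k * enorm (x - y)) -> 0 <= k ->
  W1inf_norm f <= M + k.
Proof.
move=> fM fk k0; apply: lerD; apply: ge_sup.
- by case: (has_sup_enorm f).
- by move=> _ [x _ <-].
- by case: (has_sup_quot f).
move=> _ [[x y] _ <-]/=; have [xy|xy] := eqVneq (enorm (x - y)) 0.
  by rewrite xy invr0 mulr0.
by rewrite ler_pdivrMr// lt_neqAle eq_sym xy enorm_ge0.
Qed.

Lemma W1inf_normD f g : W1inf_norm (f + g) <= W1inf_norm f + W1inf_norm g.
Proof.
rewrite /W1inf_norm addrACA; apply: W1inf_norm_le.
- move=> x; rewrite W1infDE (le_trans (enormD _ _))//.
  by rewrite lerD// enorm_le_sup.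
- move=> x y; rewrite W1infDE opprD addrACA (le_trans (enormD _ _))// mulrDl.
  by rewrite lerD// lipschitz_constP.
- by rewrite addr_ge0// lipschitz_const_ge0.
Qed.

Let W1inf_normZ_le a f : W1inf_norm (a *: f) <= `|a| * W1inf_norm f.
Proof.
rewrite /W1inf_norm mulrDr; apply: W1inf_norm_le.
- by move=> x; rewrite W1infZE enormZ ler_wpM2l// enorm_le_sup.
- move=> x y; rewrite W1infZE -scalerBr enormZ -mulrA ler_wpM2l//.
  exact: lipschitz_constP.
- by rewrite mulr_ge0// lipschitz_const_ge0.
Qed.

Let W1inf_norm_ge0 f : 0 <= W1inf_norm f.
Proof.
rewrite addr_ge0 ?lipschitz_const_ge0//.
exact: le_trans (enorm_ge0 _) (enorm_le_sup f 0).
Qed.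

Lemma W1inf_normZ a f : W1inf_norm (a *: f) = `|a| * W1inf_norm f.
Proof.
apply/eqP; rewrite eq_le W1inf_normZ_le/=.
have [->|a0] := eqVneq a 0; first by rewrite normr0 mul0r W1inf_norm_ge0.
have := W1inf_normZ_le a^-1 (a *: f).
by rewrite scalerA mulVf// scale1r normfV mulrC ler_pdivlMr ?normr_gt0// mulrC.
Qed.

Lemma W1inf_norm_eq0 f : W1inf_norm f = 0 -> f = 0.
Proof.
move=> f0; apply/val_inj/funext => x; change (f x = 0).
apply/enorm_eq0/eqP; rewrite eq_le enorm_ge0 andbT -f0.
by rewrite (le_trans (enorm_le_sup f x))// lerDl lipschitz_const_ge0.
Qed.

HB.instance Definition _ := Lmodule_isNormed.Build R (W1inf R d)
  W1inf_normD W1inf_normZ W1inf_norm_eq0.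

Lemma W1inf_continuous f : continuous f.
Proof.
move=> x; apply/(@cvgrPdist_le _ _ _ (nbhs x)) => e e0.
pose C := lipschitz_const f * d%:R + 1.
have C0 : 0 < C by rewrite ltr_wpDl// mulr_ge0// lipschitz_const_ge0.
near=> y; apply: le_trans (ler_norm_enorm _) _.
apply: le_trans (lipschitz_constP _ _ _) _.
apply: (@le_trans _ _ (C * `|x - y|)).
  rewrite mulrDl -mulrA -[leLHS]addr0 lerD ?mulr_ge0//.
  by rewrite ler_wpM2l ?lipschitz_const_ge0// ler_enorm_norm.
rewrite mulrC -ler_pdivlMr//; near: y.
by apply: cvgr_dist_le => //; rewrite divr_gt0.
Unshelve. all: by end_near. Qed.

End W1inf_theory.

(* R^d with its Borel sigma-algebra. *)
Notation borel_rV R d := (g_sigma_algebraType (@open 'rV[R]_d)).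

Definition perturb (R : realType) (d : nat) (theta : W1inf R d)
  : borel_rV R d -> borel_rV R d := fun x : 'rV[R]_d => x + theta x.

Section perturb_measurable.
Context {R : realType} {d : nat} (theta : W1inf R d).

Lemma measurable_perturb : measurable_fun setT (perturb theta).
Proof.
apply: (@measurability _ _ (borel_rV R d) (borel_rV R d) setT (perturb theta)
  (@open 'rV[R]_d) erefl).
move=> _ [U oU <-]; rewrite setTI; apply: sub_sigma_algebra.
have cont : continuous (fun x : 'rV[R]_d => x + theta x).
  move=> x; apply: (@cvgD _ _ _ (nbhs x) _ id theta); first exact: cvg_id.
  exact: W1inf_continuous.
by move/continuousP : cont; apply.
Qed.

HB.instance Definition _ :=
  isMeasurableFun.Build _ _ _ _ (perturb theta) measurable_perturb.

End perturb_measurable.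

Definition msupport (R : realType) (d : nat) (mu : probability (borel_rV R d) R)
  : set 'rV[R]_d :=
  [set x | forall U : set 'rV[R]_d, open U -> U x -> (0 < mu U)%E].

Definition Omega (R : realType) (d : nat) (mu : probability (borel_rV R d) R)
  : set 'rV[R]_d := interior (msupport mu).

Definition P2 (R : realType) (d : nat) (mu : probability (borel_rV R d) R)
  : Prop :=
  (\int[mu]_x ((enorm (x : 'rV[R]_d) ^+ 2)%:E) < +oo)%E.

Definition Pad (R : realType) (d : nat) (Oad : set (set 'rV[R]_d))
  (mu : probability (borel_rV R d) R) : Prop := P2 mu /\ Oad (Omega mu).

Definition admissible (R : realType) (d : nat) (Oad : set (set 'rV[R]_d))
  : Prop :=
  Oad `<=` open /\
  forall Om, Oad Om -> exists2 r : R, 0 < r &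
    forall theta : W1inf R d, `|theta| < r -> Oad (perturb theta @` Om).

(* A functional on an admissible family is represented by a total function on
   sets: for Om in the family and theta small, perturb theta @` Om stays in the
   family, so the values of J outside it play no role. *)
Definition is_shape_derivative (R : realType) (d : nat)
    (J : set 'rV[R]_d -> R) (Om : set 'rV[R]_d)
    (dJ : {linear W1inf R d -> R^o}) : Prop :=
  (exists C : R, forall theta, `|dJ theta| <= C * `|theta|) /\
  (J (perturb theta @` Om) - J Om - dJ theta) / `|theta|
    @[theta --> (0 : W1inf R d)^'] --> (0 : R).

Definition Jtilde (R : realType) (d : nat) (J : set 'rV[R]_d -> R)
  (mu : probability (borel_rV R d) R) : R := J (Omega mu).

(* Main.v *)
Require Import Defs.
From HB Require Import structures.
From mathcomp Require Import all_boot all_order all_algebra.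
From mathcomp Require Import lra measurable_realfun.
From mathcomp Require Import all_classical all_reals all_analysis.

Set Implicit Arguments.
Unset Strict Implicit.
Unset Printing Implicit Defensive.

Import Order.TTheory GRing.Theory Num.Theory.
Import numFieldNormedType.Exports.

Local Open Scope classical_set_scope.
Local Open Scope ring_scope.

(* If theta is small then x |-> x + theta x is a homeomorphism of R^d by
   Banach's fixed point theorem (the contraction being measured in the maximum
   norm, which costs a factor d). A homeomorphism carries the support of mu to
   the support of the push-forward and interiors to interiors, so that
   Omega ((Id + t theta)_# mu) = (Id + t theta)(Omega mu) for all t near 0, of
   either sign; it remains to restrict the expansion defining the shape
   derivative to the line spanned by theta. *)

(* The library does not join the complete and the normed structures of
   'rV[R]_d. *)
HB.instance Definition _ (R : realType) (d : nat) := Complete.on 'rV[R]_d.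

(** A solution of x + g x = y is a fixed point of the contraction x |-> y - g x, which gives
    surjectivity; injectivity and continuity of the inverse come from a lower bound on distances. *)
Lemma add_contraction_homeo (R : realType) (V : completeNormedModType R)
    (k : R) (g : V -> V) : 0 <= k -> k < 1 ->
  (forall x y, `|g x - g y| <= k * `|x - y|) ->
  exists psi : V -> V, [/\ continuous psi,
    cancel (fun x => x + g x) psi & cancel psi (fun x => x + g x)].
Proof.
move=> k0 k1 gk.
(* By the reverse triangle inequality; any right inverse is thus Lipschitz with constant 1 / (1 -
   k). *)
have expand x y : (1 - k) * `|x - y| <= `|(x + g x) - (y + g y)|.
  rewrite mulrBl mul1r lerBlDr opprD addrACA -lerBlDr.
  apply: le_trans (lerB_normD _ _).
  by rewrite lerD2l lerN2.
have k1' : 0 < 1 - k by rewrite subr_gt0.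
have surj y : exists x, x + g x = y.
  pose h := totalfun (fun x => y - g x).
  have ctr : is_contraction h.
    exists (NngNum k0); split => //= -[x z] _ /=.
    by rewrite opprB addrC addrA subrK -normrN opprB.
  have [x _ xE] := banach_fixed_point ctr closedT (ex_intro _ 0 I).
  by exists x; rewrite {1}xE subrK.
have [psi psiK] := choice surj; exists psi.
have Kpsi : cancel (fun x => x + g x) psi.
  move=> x; apply/eqP; rewrite -subr_eq0 -normr_le0 -(pmulr_rle0 _ k1').
  by apply: le_trans (expand _ _) _; rewrite psiK subrr normr0.
split => // y; apply/cvgrPdist_le => e e0; near=> z.
rewrite -(ler_pM2l k1') (le_trans (expand _ _))// !psiK; near: z.
by apply: cvgr_dist_le => //; rewrite mulr_gt0.
Unshelve. all: by end_near. Qed.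

(** An image under [f] is a preimage under [g], so openness passes both ways, and each inclusion
    follows because the interior is the largest open subset. *)
Lemma interior_image_homeo (S T : topologicalType) (f : S -> T) (g : T -> S)
    (A : set S) : continuous f -> continuous g -> cancel f g -> cancel g f ->
  interior (f @` A) = f @` interior A.
Proof.
move=> /continuousP cf /continuousP cg fK gK.
have imf B : f @` B = g @^-1` B.
  apply/seteqP; split => [_ [x Bx <-]|y By] /=; first by rewrite fK.
  by exists (g y).
rewrite imf imf; apply/seteqP; split => [y Ay|].
  suff sub : f @^-1` interior (g @^-1` A) `<=` interior A.
    by apply: sub; rewrite /= gK.
  rewrite -open_subsetE; last exact/cf/open_interior.
  by move=> x /interior_subset; rewrite /= fK.
rewrite -open_subsetE; last exact/cg/open_interior.
by move=> y /interior_subset.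
Qed.

(** Open neighbourhoods of x and of f x correspond under the homeomorphism, with equal masses for
    [mu] and [nu]. *)
Lemma msupport_image_homeo (R : realType) (d : nat)
    (mu nu : probability (borel_rV R d) R) (f g : 'rV[R]_d -> 'rV[R]_d) :
  (forall A, nu A = mu (f @^-1` A)) ->
  continuous f -> continuous g -> cancel f g -> cancel g f ->
  msupport nu = f @` msupport mu.
Proof.
move=> nuE /continuousP cf /continuousP cg fK gK.
apply/seteqP; split => [y suppy|_ [x suppx <-] V oV Vfx].
  exists (g y); last exact: gK.
  move=> U oU Uy; have := suppy (g @^-1` U) (cg _ oU) Uy.
  rewrite nuE; congr (0 < mu _)%E.
  by apply/funext => x /=; rewrite fK.
by rewrite nuE; apply: suppx => //; exact: cf.
Qed.

Lemma lipschitz_const_le_norm (R : realType) (d : nat) (theta : W1inf R d) :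
  lipschitz_const theta <= `|theta|.
Proof.
rewrite [leRHS]/Num.norm/= /W1inf_norm lerDr.
exact: le_trans (enorm_ge0 _) (enorm_le_sup theta 0).
Qed.

Lemma Omega_perturb (R : realType) (d : nat)
    (mu : probability (borel_rV R d) R) (theta : W1inf R d) :
  `|theta| * d%:R < 1 ->
  Omega (distribution mu (perturb theta)) = perturb theta @` Omega mu.
Proof.
move=> theta1.
(* [lipschitz_const] is Euclidean; bounding [enorm] by the maximum norm brings in the factor d. *)
have lip x y : `|theta x - theta y| <= `|theta| * d%:R * `|x - y|.
  apply: le_trans (ler_norm_enorm _) _.
  apply: le_trans (lipschitz_constP _ _ _) _.
  rewrite -mulrA ler_pM ?lipschitz_const_ge0 ?enorm_ge0//.
    exact: lipschitz_const_le_norm.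
  exact: ler_enorm_norm.
have k0 : 0 <= `|theta| * d%:R by rewrite mulr_ge0.
have [psi [cpsi psiK Kpsi]] := add_contraction_homeo k0 theta1 lip.
have cphi : continuous (fun x : 'rV[R]_d => x + theta x).
  move=> x; apply: (@cvgD _ _ _ (nbhs x) _ id theta); first exact: cvg_id.
  exact: W1inf_continuous.
rewrite /Omega (@msupport_image_homeo _ _ mu _ _ _ _ cphi cpsi psiK Kpsi)//.
exact: interior_image_homeo cphi cpsi psiK Kpsi.
Qed.

(** Open intervals generate the Borel sets of the line, and their preimages are open. *)
Lemma continuous_measurable_rV (R : realType) (d : nat) (f : 'rV[R]_d -> R) :
  continuous f -> measurable_fun setT (f : borel_rV R d -> R).
Proof.
move=> /continuousP cf; apply: (measurability _ (RGenOpens.measurableE R)).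
move=> _ [_ [a [b ->] <-]]; rewrite setTI; apply: sub_sigma_algebra.
exact/cf/interval_open.
Qed.

Lemma measurable_sqr_enorm (R : realType) (d : nat) :
  measurable_fun setT (fun x : borel_rV R d => enorm (x : 'rV[R]_d) ^+ 2).
Proof.
under eq_fun do rewrite sqr_enorm.
apply: measurable_sum => i; apply: measurable_funX.
exact: (continuous_measurable_rV (@coord_continuous R 1 d ord0 i)).
Qed.

(** With M a bound of theta, the squared norm of x + theta x is at most 2|x|^2 + 2M^2, which is
    integrable for a probability with finite second moment. *)
Lemma P2_perturb (R : realType) (d : nat)
    (mu : probability (borel_rV R d) R) (theta : W1inf R d) :
  P2 mu -> P2 (distribution mu (perturb theta)).
Proof.
move=> mu2; have msq := @measurable_sqr_enorm R d.
rewrite /P2 ge0_integral_distribution; last 2 first.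
- exact/measurable_EFinP.
- by move=> x; rewrite lee_fin sqr_ge0.
set M := sup (range (fun x => enorm (theta x))).
pose g (x : borel_rV R d) := (enorm (x : 'rV[R]_d) ^+ 2)%:E.
have mg : measurable_fun setT g by exact/measurable_EFinP.
have g0 x : (0 <= g x)%E by rewrite lee_fin sqr_ge0.
apply: (@le_lt_trans _ _ (\int[mu]_x (2%:E * g x + cst (2 * M ^+ 2)%:E x))%E).
  apply: ge0_le_integral => //.
  - by move=> x _; rewrite lee_fin sqr_ge0.
  - apply/measurable_EFinP.
    exact: (measurableT_comp msq (measurable_perturb theta)).
  - by apply: emeasurable_funD => //; exact: measurable_funeM.
  - move=> x _; rewrite /= lee_fin.
    have le1 : enorm (perturb theta x : 'rV[R]_d) <= enorm (x : 'rV[R]_d) + M.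
      apply: le_trans (enormD _ _) _; rewrite lerD2l.
      exact: enorm_le_sup.
    have M0 : 0 <= M := le_trans (enorm_ge0 _) (enorm_le_sup theta 0).
    have := enorm_ge0 (perturb theta x : 'rV[R]_d).
    have := enorm_ge0 (x : 'rV[R]_d).
    move: le1; move: (enorm (perturb _ _ : 'rV[R]_d)) (enorm (x : 'rV[R]_d)).
    move=> a b ab b0 a0.
    apply: (@le_trans _ _ ((b + M) ^+ 2)).
      by rewrite ler_sqr ?nnegrE// addr_ge0.
    (* The right side minus the left side is exactly (b - M)^2. *)
    have := sqr_ge0 (b - M); nra.
rewrite ge0_integralD//; last 3 first.
- by move=> x _; rewrite mule_ge0.
- exact: measurable_funeM.
- by move=> x _; rewrite lee_fin mulr_ge0// sqr_ge0.
rewrite ge0_integralZl// integral_cst//= probability_setT mule1.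
by rewrite lte_add_pinfty ?ltry// lte_mul_pinfty.
Qed.

Lemma cvg_is_derive0 (R : realType) (f : R -> R) (l : R) :
  h^-1 * (f h - f 0) @[h --> (0 : R)^'] --> l -> is_derive (0 : R) (1 : R) f l.
Proof.
move=> fl.
have cv : h^-1 *: ((f \o shift (0 : R)) (h *: (1 : R)) - f 0)
    @[h --> (0 : R)^'] --> l.
  apply: cvg_trans fl; apply: near_eq_cvg; near=> h.
  by rewrite /= addr0 [h *: _]mulr1.
apply: DeriveDef; first by apply/cvg_ex; exists l.
exact: cvg_lim cv.
Unshelve. all: by end_near. Qed.

Lemma perturb0 (R : realType) (d : nat) : perturb (0 : W1inf R d) = id.
Proof. by apply/funext => x; exact: addr0. Qed.

Lemma is_shape_derivative_line (R : realType) (d : nat)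
    (J : set 'rV[R]_d -> R) (Om : set 'rV[R]_d)
    (dJ : {linear W1inf R d -> R^o}) (theta : W1inf R d) :
  is_shape_derivative J Om dJ ->
  t^-1 * (J (perturb (t *: theta) @` Om) - J Om) @[t --> (0 : R)^'] -->
  (dJ theta : R).
Proof.
(* The zero direction is set apart: the limit in [dJP] runs over nonzero perturbations, which the
   line t *: theta meets only if theta is nonzero. *)
move=> [_ dJP]; have [->|theta0] := eqVneq theta 0.
  rewrite linear0; apply: cvg_near_cst; near=> t.
  by rewrite scaler0 perturb0 image_id subrr mulr0.
have line : t *: theta @[t --> (0 : R)^'] --> (0 : W1inf R d)^'.
  move=> A /nbhs_ballP[e /= e0 eA]; near_simpl; near=> t.
  apply: eA; last first.
    rewrite scaler_eq0 negb_or theta0 andbT; near: t.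
    exact: nbhs_dnbhs_neq.
  rewrite -ball_normE/= sub0r normrN normrZ -ltr_pdivlMr ?normr_gt0//.
  by near: t; apply: dnbhs0_lt; rewrite divr_gt0// normr_gt0.
have quot := cvg_comp _ _ line dJP.
apply/cvgrPdist_le => e e0; near=> t.
have t0 : t != 0 by near: t; exact: nbhs_dnbhs_neq.
have nt0 : 0 < `|t| by rewrite normr_gt0.
(* Since |t *: theta| = |t| |theta|, the tolerance e / |theta| leaves a remainder of at most e |t|,
   hence e after division by |t|. *)
have : `|(J (perturb (t *: theta) @` Om) - J Om - dJ (t *: theta)) /
    `|t *: theta| | <= e / `|theta|.
  near: t.
  have e1 : 0 < e / `|theta| by rewrite divr_gt0// normr_gt0.
  have /cvgrPdist_le/(_ _ e1) := quot.
  by apply: filterS => t /=; rewrite sub0r normrN.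
rewrite normrM normfV normr_id normrZ ler_pdivrMr ?mulr_gt0 ?normr_gt0//.
rewrite mulrCA divfK ?normr_eq0// linearZ/= => le1.
rewrite distrC -(ler_pM2l nt0) -normrM mulrBr mulrA divff// mul1r.
exact: le1.
Unshelve. all: by end_near. Qed.

Theorem proposition1 (R : realType) (d : nat) (Oad : set (set 'rV[R]_d))
    (J : set 'rV[R]_d -> R) (mu : probability (borel_rV R d) R)
    (dJ : {linear W1inf R d -> R^o}) :
  admissible Oad ->
  Pad Oad mu ->
  is_shape_derivative J (Omega mu) dJ ->
  forall theta : W1inf R d,
    (\forall t \near (0 : R)^'+, Pad Oad (distribution mu (perturb (t *: theta)))) /\
    is_derive (0 : R) (1 : R)
      (fun t : R => Jtilde J (distribution mu (perturb (t *: theta))))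
      (dJ theta).
Proof.
move=> [_ adm] [mu2 OadO] dJP theta.
have small (e : R) : 0 < e -> \forall t \near (0 : R), `|t *: theta| < e.
  move=> e0; near=> t; rewrite normrZ.
  (* The added 1 keeps the divisor positive when theta = 0. *)
  have theta0 : 0 < `|theta| + 1 by rewrite ltr_wpDl.
  apply: (@le_lt_trans _ _ (`|t| * (`|theta| + 1))).
    by rewrite ler_wpM2l// lerDl.
  rewrite -ltr_pdivlMr//; near: t; apply: (@nbhs0_lt R R^o); exact: divr_gt0.
have Ot : \forall t \near (0 : R),
    Omega (distribution mu (perturb (t *: theta))) =
    perturb (t *: theta) @` Omega mu.
  near=> t; apply: Omega_perturb.
  (* Passing to [d.+1] keeps the divisor positive when d = 0. *)
  apply: (@le_lt_trans _ _ (`|t *: theta| * d.+1%:R)).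
    by rewrite ler_wpM2l// ler_nat.
  by rewrite -ltr_pdivlMr// mul1r; near: t; exact: small.
have [r r0 rO] := adm _ OadO.
split.
  apply: cvg_within; near=> t; split; first exact: P2_perturb.
  by rewrite (near Ot t)//; apply: rO; near: t; exact: small.
apply: cvg_is_derive0.
apply: cvg_trans (is_shape_derivative_line (theta := theta) dJP).
apply: near_eq_cvg; near=> t.
(* [Ot] holds in particular at t = 0, so the value subtracted in the difference quotient is J (Omega
   mu). *)
rewrite /Jtilde (nbhs_singleton Ot) scale0r perturb0 image_id.
rewrite (_ : Omega (distribution _ _) = perturb (t *: theta) @` Omega mu)//.
by near: t; exact: nbhs_dnbhs Ot.
Unshelve. all: by end_near. Qed.
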